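(* Let $L$ be a thin Lie algebra over a field of arbitrary characteristic $p$ (possibly zero), with second diamond $L_k$, and suppose that $L/L^k$ is metabelian. Then $k$ equals one of $3$, $5$, or, in case $p>0$, $q$ or $2q-1$ for some power $q$ of $p$. However, if $p=2$ then $k$ equals either $3$ or $2q-1$ for some power $q$ of $2$.
   Context: A thin Lie algebra is an infinite-dimensional graded Lie algebra $L=\bigoplus_{i=1}^{\infty}L_i$, with all $L_i\neq 0$ (so that, by the covering property below, $L$ is generated by $L_1$), with $\dim L_1=2$, satisfying the covering property: for each $i\ge 1$, each nonzero $z\in L_i$ satisfies $[z,L_1]=L_{i+1}$. It follows that every homogeneous component $L_i$ has dimension one or two; the components of dimension two are called diamonds, so $L_1$ is a diamond. By convention, a thin Lie algebra is required to have at least one diamond besides $L_1$ (i.e. graded Lie algebras of maximal class, those with $\dim L_i=1$ for all $i>1$, are excluded). The second diamond is $L_k$, where $k$ is the least integer $k>1$ with $\dim L_k=2$. Here $L^k$ denotes the $k$-th Lie power of $L$ (the $k$-th term of the lower central series), which equals $\bigoplus_{i\ge k}L_i$; thus $L/L^k$ is metabelian if and only if $[L^2,L^2]\subseteq L^k$. *)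

(* Defs.v *)
From HB Require Import structures.
From mathcomp Require Import all_boot all_order all_algebra.
From mathcomp Require Import boolp classical_sets.

Set Implicit Arguments.
Unset Strict Implicit.
Unset Printing Implicit Defensive.

Import GRing.Theory.

Local Open Scope classical_set_scope.
Local Open Scope quotient_scope.
Local Open Scope ring_scope.

HB.mixin Record Lmodule_isLie (F : fieldType) L of GRing.Lmodule F L := {
  lie : L -> L -> L;
  lie_linearl : forall y, linear (lie^~ y);
  lie_linearr : forall x, linear (lie x);
  liexx : forall x, lie x x = 0;
  lie_jacobi : forall x y z,
    lie x (lie y z) + lie y (lie z x) + lie z (lie x y) = 0
}.

#[short(type="lieAlgType")]
HB.structure Definition LieAlg (F : fieldType) :=
  {L of Lmodule_isLie F L & GRing.Lmodule F L}.

Section LieTheory.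
Variables (F : fieldType) (L : lieAlgType F).
Implicit Types x y z : L.

Definition lier y x := lie x y.

HB.instance Definition _ y :=
  GRing.isLinear.Build F L L *:%R (lier y) (lie_linearl y).
HB.instance Definition _ x :=
  GRing.isLinear.Build F L L *:%R (lie x) (lie_linearr x).

Lemma lieDl x y z : lie (x + y) z = lie x z + lie y z.
Proof. exact: (raddfD (lier z)). Qed.

Lemma lieDr x y z : lie x (y + z) = lie x y + lie x z.
Proof. exact: raddfD. Qed.

Lemma lieBl x y z : lie (x - y) z = lie x z - lie y z.
Proof. exact: (raddfB (lier z)). Qed.

Lemma lieBr x y z : lie x (y - z) = lie x y - lie x z.
Proof. exact: raddfB. Qed.

Lemma lieZl a x y : lie (a *: x) y = a *: lie x y.
Proof. exact: (linearZ_LR (lier y)). Qed.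

Lemma lieZr a x y : lie x (a *: y) = a *: lie x y.
Proof. exact: linearZ_LR. Qed.

Lemma lieC x y : lie x y = - lie y x.
Proof.
have := liexx (x + y); rewrite lieDl !lieDr !liexx add0r addr0.
by move/eqP; rewrite addr_eq0 => /eqP.
Qed.

Definition lin_span (S : set L) : set L :=
  [set z | exists n (c : 'I_n -> F) (v : 'I_n -> L),
     (forall i, S (v i)) /\ z = \sum_i c i *: v i].

Lemma lin_span_submod S : submod_closed [in lin_span S].
Proof.
split=> [|a x y]; rewrite !inE.
  exists 0%N, (fun=> 0), (fun=> 0); split; first by case.
  by rewrite big_ord0.
move=> [m [c [v [Sv ->]]]] [n [d [w [Sw ->]]]].
exists (m + n)%N,
  (fun i => match split i with inl j => a * c j | inr j => d j end),
  (fun i => match split i with inl j => v j | inr j => w j end).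
split=> [i|]; first by case: split.
rewrite big_split_ord scaler_sumr /=; congr (_ + _); apply: eq_bigr => i _.
  by rewrite -[lshift _ _]/(unsplit (inl i)) unsplitK scalerA.
by rewrite -[rshift _ _]/(unsplit (inr i)) unsplitK.
Qed.

Lemma sub_lin_span (S : set L) : S `<=` lin_span S.
Proof.
move=> x Sx; exists 1%N, (fun=> 1), (fun=> x); split=> //.
by rewrite big_ord1 scale1r.
Qed.

Definition lie_prod (A B : set L) : set L :=
  lin_span [set lie x y | x in A & y in B].

(* [lie_power n] is L^n for n >= 1, starting at L^1 = L; L^0 is a dummy. *)
Fixpoint lie_power (n : nat) : set L :=
  if n is m.+1 then
    if m is 0%N then setT else lie_prod (lie_power m) setT
  else setT.

Definition metabelian : Prop :=
  lie_prod (lie_prod setT setT) (lie_prod setT setT) = [set 0].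

(* By [lieC] there is no difference between left, right and two-sided ideals. *)
Record lie_ideal := LieIdeal {
  ideal_set :> set L;
  ideal_submod : submod_closed [in ideal_set];
  ideal_absorb : forall x y, ideal_set y -> ideal_set (lie x y)
}.

Lemma lie_power_submod n : submod_closed [in lie_power n].
Proof.
have subT : submod_closed [in [set: L]].
  by split=> [|a x y _ _]; rewrite /= in_setT.
case: n => [|[|n]] //; exact: lin_span_submod.
Qed.

Lemma lie_power_absorb n x y : lie_power n y -> lie_power n (lie x y).
Proof.
elim: n x y => [|[|n] IHn] x y //= [m [c [v [Sv ->]]]].
rewrite raddf_sum; exists m, (fun i => - c i), (fun i => lie (v i) x).
split=> [i|]; last first.
  by apply: eq_bigr => i _; rewrite /= lieZr lieC scalerN scaleNr.
exists (v i) => //; last by exists x.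
have [a Aa [b _ <-]] := Sv i.
have [A0 /(_ (-1) (lie b a) 0)] := lie_power_submod n.+1.
rewrite addr0 scaleN1r -lieC => /(_ (mem_set (IHn _ _ Aa)) A0).
exact: set_mem.
Qed.

Definition lie_power_ideal n : lie_ideal :=
  LieIdeal (lie_power_submod n) (@lie_power_absorb n).

End LieTheory.

Arguments metabelian {F} L.
Arguments lie_power_ideal {F} L n.

Section LieQuotient.
Variables (F : fieldType) (L : lieAlgType F) (I : lie_ideal L).

Definition ideal_pred : pred L := [in ideal_set I].

HB.instance Definition _ :=
  GRing.isSubmodClosed.Build F L ideal_pred (ideal_submod I).

Definition lie_quot :=
  Quotient.quot (GRing.ZmodClosed.clone L ideal_pred _).
HB.instance Definition _ := GRing.Zmodule.on lie_quot.
HB.instance Definition _ := Quotient.on lie_quot.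

Lemma lie_quotP (x y : L) :
  reflect (\pi_lie_quot x = \pi_lie_quot y) (x - y \in ideal_pred).
Proof. by rewrite Quotient.idealrBE; exact: eqP. Qed.

Lemma pi_lie_quotD (x y : L) :
  \pi_lie_quot (x + y) = \pi_lie_quot x + \pi_lie_quot y.
Proof. exact: pi_addr. Qed.

Definition quot_scale (a : F) := lift_op1 lie_quot ( *:%R a).
Definition quot_lie := lift_op2 lie_quot (@lie F L).

Lemma pi_scale a (x : L) :
  quot_scale a (\pi_lie_quot x) = \pi_lie_quot (a *: x).
Proof.
unlock quot_scale; apply/lie_quotP; rewrite -scalerBr rpredZ //.
by apply/lie_quotP; rewrite reprK.
Qed.

Lemma pi_lie (x y : L) :
  quot_lie (\pi_lie_quot x) (\pi_lie_quot y) = \pi_lie_quot (lie x y).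
Proof.
have E z : repr (\pi_lie_quot z) - z \in ideal_pred.
  by apply/lie_quotP; rewrite reprK.
unlock quot_lie; apply/lie_quotP; set x' := repr _; set y' := repr _.
have -> : lie x' y' - lie x y = lie x' (y' - y) - lie y (x' - x).
  by rewrite !lieBr (lieC y x') (lieC y x) opprK opprD opprK addrA subrK.
by apply: rpredB; apply/mem_set/ideal_absorb/set_mem; exact: E.
Qed.

Fact quot_scaleA a b u :
  quot_scale a (quot_scale b u) = quot_scale (a * b) u.
Proof. by elim/quotW: u => x; rewrite !pi_scale scalerA. Qed.

Fact quot_scale1 : left_id 1 quot_scale.
Proof. by elim/quotW=> x; rewrite pi_scale scale1r. Qed.

Fact quot_scaleDr : right_distributive quot_scale +%R.
Proof.
move=> a; elim/quotW=> x; elim/quotW=> y.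
by rewrite -pi_lie_quotD !pi_scale scalerDr pi_lie_quotD.
Qed.

Fact quot_scaleDl u : {morph quot_scale^~ u : a b / a + b}.
Proof.
by elim/quotW: u => x a b; rewrite !pi_scale scalerDl pi_lie_quotD.
Qed.

HB.instance Definition _ := GRing.Zmodule_isLmodule.Build F lie_quot
  quot_scaleA quot_scale1 quot_scaleDr quot_scaleDl.

Lemma pi_lie_quotZ a (x : L) : \pi_lie_quot (a *: x) = a *: \pi_lie_quot x.
Proof. by rewrite -pi_scale. Qed.

Fact quot_lie_linearl v : linear (quot_lie^~ v).
Proof.
move=> a; elim/quotW=> x; elim/quotW=> y; elim/quotW: v => z.
rewrite -pi_lie_quotZ -pi_lie_quotD !pi_lie -pi_lie_quotZ -pi_lie_quotD.
by rewrite lie_linearl.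
Qed.

Fact quot_lie_linearr v : linear (quot_lie v).
Proof.
move=> a; elim/quotW=> x; elim/quotW=> y; elim/quotW: v => z.
rewrite -pi_lie_quotZ -pi_lie_quotD !pi_lie -pi_lie_quotZ -pi_lie_quotD.
by rewrite lie_linearr.
Qed.

Fact pi_lie_quot0 : \pi_lie_quot 0 = 0.
Proof. exact: pi_zeror. Qed.

Fact quot_liexx u : quot_lie u u = 0.
Proof. by elim/quotW: u => x; rewrite pi_lie liexx pi_lie_quot0. Qed.

Fact quot_lie_jacobi u v w :
  quot_lie u (quot_lie v w) + quot_lie v (quot_lie w u)
    + quot_lie w (quot_lie u v) = 0.
Proof.
elim/quotW: u => x; elim/quotW: v => y; elim/quotW: w => z.
by rewrite !pi_lie -!pi_lie_quotD lie_jacobi pi_lie_quot0.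
Qed.

HB.instance Definition _ := Lmodule_isLie.Build F lie_quot
  quot_lie_linearl quot_lie_linearr quot_liexx quot_lie_jacobi.

End LieQuotient.

Section Thin.
Variables (F : fieldType) (L : lieAlgType F).
Implicit Types (A : set L) (g : nat -> set L).

Definition has_dim A (n : nat) : Prop :=
  exists b : 'I_n -> L,
    (forall c : 'I_n -> F, \sum_i c i *: b i = 0 -> forall i, c i = 0) /\
    A = [set x | exists c : 'I_n -> F, x = \sum_i c i *: b i].

(* The components are indexed by i >= 1; the value [g 0] is irrelevant. *)
Record lie_grading g : Prop := {
  grading_submod : forall i, (0 < i)%N -> submod_closed [in g i];
  grading_lie : forall i j x y, (0 < i)%N -> (0 < j)%N ->
    g i x -> g j y -> g (i + j)%N (lie x y);
  grading_sum : forall x, exists n (c : nat -> L),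
    (forall i, (0 < i)%N -> g i (c i)) /\ x = \sum_(1 <= i < n) c i;
  grading_direct : forall n (c : nat -> L),
    (forall i, (0 < i)%N -> g i (c i)) -> \sum_(1 <= i < n) c i = 0 ->
    forall i, (0 < i < n)%N -> c i = 0
}.

(* Infinite-dimensionality of L is a consequence of [thin_neq0]. *)
Record thin g : Prop := {
  thin_grading : lie_grading g;
  thin_neq0 : forall i, (0 < i)%N -> g i <> [set 0];
  thin_dim1 : has_dim (g 1%N) 2;
  thin_covering : forall i z, (0 < i)%N -> g i z -> z <> 0 ->
    [set lie z y | y in g 1%N] = g i.+1;
  thin_diamond : exists2 i, (1 < i)%N & has_dim (g i) 2
}.

Definition second_diamond g (k : nat) : Prop :=
  [/\ (1 < k)%N, has_dim (g k) 2 &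
      forall i, (1 < i < k)%N -> ~ has_dim (g i) 2].

End Thin.

Definition has_char (F : fieldType) (p : nat) : Prop :=
  if p is 0%N then [pchar F] =i pred0 else p \in [pchar F].

Definition is_power (p q : nat) : Prop := exists2 e, (0 < e)%N & q = (p ^ e)%N.

(* Main.v *)
(** Write [[a b c]] for [[[a,b],c]], let [m = (k-1)/2], [h = k-2], and suppose
    [k > 3].  Since [L/L^k] is metabelian, one can choose a basis [x, y] of
    [L_1] such that [y] centralizes [L_2, ..., L_h]; so [e_n = [y x^n]] spans
    [L_(n+1)] for [0 < n <= h], and [e_(h+1)], [w = [e_h y]] form a basis of
    [L_k].  Expanding [[e_i, e_j]] in degrees [k] and [k+1], skew-symmetry
    forces [k] odd and [[e_(h+1) y] = m [w x]]; the covering property then gives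
    [m <> 0] in [F].

    As long as [[w x^t y] = 0] for [t < s], one has
    [[e_i, e_j] = +- c_s(j) [w x^s]] for [i + j = h + s], where
    [c_s(j) = C(j,s) - m C(j,s-1)].  Two consequences are played against each
    other: [0 = [e_i, [e_j, y]]] gives [[w x^s y] = 0] as soon as [c_s(j)] is
    nonzero for some [s < j < h], and then skew-symmetry relates [c_s(j)] and
    [c_s(i)].  If neither [k] nor [k+1] vanishes in [F], this is contradictory
    at [s = 3] unless [k = 5], since [6 c_3(m+1) = - m (m+1) (2m+1)].  If [k] or
    [k+1] equals [N Q] with [Q] the exact power of [p] dividing it, reduction of
    binomial coefficients modulo [p] gives a contradiction at [s = Q] unless
    [N <= 2]. *)
Require Import Defs.
From mathcomp Require Import all_boot all_order all_algebra.
From mathcomp Require Import boolp classical_sets.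
From mathcomp Require Import zify ring.

Set Implicit Arguments.
Unset Strict Implicit.
Unset Printing Implicit Defensive.

Import GRing.Theory.

(** * Binomial coefficients modulo p *)

Section Binomials.
Local Open Scope ring_scope.
Variables (F : fieldType) (p : nat).
Hypothesis charFp : p \in [pchar F].

(** Put Q = [p ^ e]. By i C(Q,i) = Q C(Q-1,i-1), if p did not divide C(Q,i), then Q would divide the
    smaller number i. *)
Lemma bin_pchar_pow e i : (0 < i < p ^ e)%N -> 'C(p ^ e, i)%:R = 0 :> F.
Proof.
have p_pr := pcharf_prime charFp.
case: i => // i /andP[_ lti]; apply/eqP; rewrite -(dvdn_pcharf charFp).
apply/negPn/negP; rewrite -prime_coprime // => cop.
have: (p ^ e %| i.+1 * 'C(p ^ e, i.+1))%N by rewrite -mul_bin_diag dvdn_mulr.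
rewrite Gauss_dvdl ?coprimeXl //.
by move=> /(dvdn_leq (ltn0Sn i)); rewrite leqNgt lti.
Qed.

(** This reflects (1+X)^Q = 1 + X^Q for Q = [p ^ e]: in the Vandermonde convolution only the extreme
    terms of row Q survive. *)
Lemma bin_pchar_addl e n s : (s <= p ^ e)%N ->
  'C(p ^ e + n, s)%:R = 'C(n, s)%:R + (s == p ^ e)%N%:R :> F.
Proof.
have Q_gt0 : (0 < p ^ e)%N by rewrite expn_gt0 prime_gt0 ?(pcharf_prime charFp).
move=> le_sQ; rewrite -binomial.Vandermonde natr_sum big_ord_recl bin0 mul1n subn0.
congr (_ + _); case: s le_sQ => [_|s lt_sQ].
  by rewrite big_ord0 eq_sym (gtn_eqF Q_gt0).
rewrite big_ord_recr /= big1 ?add0r => [|i _]; last first.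
  rewrite natrM bin_pchar_pow ?mul0r //= /bump add1n /=.
  exact: leq_ltn_trans (ltn_ord i) lt_sQ.
rewrite /bump /= add1n subnn bin0 muln1.
move: lt_sQ; rewrite leq_eqVlt => /predU1P[->|ltsQ]; first by rewrite binn eqxx.
by rewrite bin_pchar_pow // (ltn_eqF ltsQ).
Qed.

Lemma bin_pchar_eq e b r : (r < p ^ e)%N ->
  'C(b * p ^ e + r, p ^ e)%:R = b%:R :> F.
Proof.
move=> ltrQ; elim: b => [|b IHb]; first by rewrite bin_small.
by rewrite mulSn -addnA bin_pchar_addl // IHb eqxx -natr1.
Qed.

End Binomials.

(** * Left-normed expansions *)

Section LieIdentities.
Local Open Scope ring_scope.
Variables (F : fieldType) (L : lieAlgType F).
Implicit Types a b c x y z : L.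

Lemma lie0l x : lie 0 x = 0 :> L.
Proof. exact: (raddf0 (lier x)). Qed.

Lemma lieNl x y : lie (- x) y = - lie x y.
Proof. exact: (raddfN (lier y)). Qed.

Lemma lie_liel a b c : lie a (lie b c) = lie (lie a b) c - lie (lie a c) b.
Proof.
have := lie_jacobi a b c.
rewrite (lieC b (lie c a)) (lieC c (lie a b)) (lieC c a) lieNl opprK => H.
by apply/eqP; rewrite -subr_eq0 opprB addrA H.
Qed.

Lemma iter_lier0 n x : iter n (lier x) 0 = 0.
Proof. by elim: n => //= n ->; rewrite raddf0. Qed.

Lemma iter_lierZ n x (k : F) z : iter n (lier x) (k *: z) = k *: iter n (lier x) z.
Proof. by elim: n => //= n ->; rewrite linearZ. Qed.

(** The iterated Jacobi identity for [a, [y x^n]]; the induction splits off the last [x] and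
    recombines by Pascal's rule. *)
Lemma lie_iter_lier n a x y :
  lie a (iter n (lier x) y) =
  \sum_(t < n.+1) ((-1) ^+ t * 'C(n, t)%:R) *:
    iter (n - t) (lier x) (lie (iter t (lier x) a) y).
Proof.
elim: n a => [|n IHn] a; first by rewrite big_ord1 expr0 mul1r scale1r.
rewrite /= {1}/lier lie_liel -/(lier x a) !IHn.
rewrite -/(lier x _) raddf_sum big_ord_recl [in RHS]big_ord_recl /=.
rewrite linearZ /= subn0 !bin0 -addrA; congr (_ + _).
have -> : \sum_(i < n) lier x (((-1) ^+ bump 0 i * 'C(n, bump 0 i)%:R) *:
    iter (n - bump 0 i) (lier x) (lie (lier x (iter i (lier x) a)) y)) =
  \sum_(t < n.+1) ((-1) ^+ t.+1 * 'C(n, t.+1)%:R) *: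
    iter (n - t) (lier x) (lie (iter t.+1 (lier x) a) y).
  rewrite [RHS]big_ord_recr /= bin_small // mulr0 scale0r addr0.
  apply: eq_bigr => i _; rewrite linearZ /= /bump /= add1n; congr (_ *: _).
  by rewrite -[lier x (iter _ _ _)]iterS subnSK.
rewrite -sumrB; apply: eq_bigr => i _.
rewrite -iterSr /= /bump /= add1n subSS -scalerBl; congr (_ *: _).
by rewrite binS natrD mulrDr !exprS; ring.
Qed.

End LieIdentities.

(** * Subspaces given as sets *)

Section Submodules.
Local Open Scope ring_scope.
Variables (F : fieldType) (L : lieAlgType F) (A : set L).
Hypothesis subA : submod_closed [in A].

Lemma submod0 : A 0.
Proof. by case: subA => /set_mem. Qed.

Lemma submodZD (a : F) u v : A u -> A v -> A (a *: u + v).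
Proof. by case: subA => _ H Au Av; apply/set_mem/H; exact: mem_set. Qed.

Lemma submodD u v : A u -> A v -> A (u + v).
Proof. by rewrite -{2}[u]scale1r; exact: submodZD. Qed.

Lemma submodZ (a : F) u : A u -> A (a *: u).
Proof. by move=> Au; rewrite -[_ *: _]addr0; exact: submodZD Au submod0. Qed.

Lemma submod_sum (I : Type) (r : seq I) (P : pred I) (f : I -> L) :
  (forall i, P i -> A (f i)) -> A (\sum_(i <- r | P i) f i).
Proof. by move=> Af; apply: big_ind => //; [exact: submod0 | exact: submodD]. Qed.

End Submodules.

(** * Tails of a grading and Lie powers *)

Section Grading.
Local Open Scope ring_scope.
Variables (F : fieldType) (L : lieAlgType F) (g : nat -> set L).
Hypothesis gradL : lie_grading g.

(** The cutoff [N] allows two such sums to be padded to a common range. *)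
Definition grading_tail (n : nat) : set L :=
  [set z | exists N (c : nat -> L), [/\ forall i, (0 < i)%N -> g i (c i),
     forall i, (i < n)%N || (N <= i)%N -> c i = 0 & z = \sum_(1 <= i < N) c i]]%classic.

Lemma sum_nat_extend (c : nat -> L) N M : (N <= M)%N ->
  (forall i, (N <= i)%N -> c i = 0) ->
  \sum_(1 <= i < N) c i = \sum_(1 <= i < M) c i.
Proof.
move=> leNM c0; case: N leNM c0 => [|N] leNM c0.
  by rewrite !big1 // => i _; exact: c0.
rewrite [RHS](@big_cat_nat _ _ _ N.+1) //=.
rewrite [X in _ + X]big_nat_cond [X in _ + X]big1 ?addr0 //.
by move=> i /andP[/andP[]] *; exact: c0.
Qed.

Lemma grading_tail_submod n : submod_closed [in grading_tail n].
Proof.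
have sub := grading_submod gradL.
split=> [|a u v]; rewrite !inE.
  exists 0%N, (fun=> 0); split=> // [i i_gt0|]; first exact: submod0 (sub _ i_gt0).
  by rewrite big_geq.
move=> [N [c [gc c0 ->]]] [M [d [gd d0 ->]]].
exists (maxn N M), (fun i => a *: c i + d i); split=> [i i_gt0|i Hi|].
- exact (submodZD (sub _ i_gt0) a (gc _ i_gt0) (gd _ i_gt0)).
- by rewrite c0 ?d0 ?scaler0 ?addr0 //; lia.
rewrite big_split -scaler_sumr /=; congr (_ *: _ + _); apply: sum_nat_extend.
- exact: leq_maxl.
- by move=> i Hi; apply: c0; rewrite Hi orbT.
- exact: leq_maxr.
by move=> i Hi; apply: d0; rewrite Hi orbT.
Qed.

Lemma grading_tail_homog n i z : (0 < i)%N -> (n <= i)%N -> g i z ->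
  grading_tail n z.
Proof.
move=> i_gt0 le_ni gz; exists i.+1, (fun j => if j == i then z else 0).
split=> [j j_gt0|j Hj|].
- case: eqP => [-> //|_]; exact: submod0 (grading_submod gradL j_gt0).
- by case: eqP => // eji; lia.
rewrite big_nat_recr //= eqxx big_nat_cond big1 ?add0r // => j.
by rewrite andbT => /andP[_ ltji]; rewrite (ltn_eqF ltji).
Qed.

Lemma grading_tail_eq0 n i z : (0 < i < n)%N -> g i z -> grading_tail n z ->
  z = 0.
Proof.
move=> /andP[i_gt0 lt_in] gz [N [c [gc c0 zE]]].
(* Moving [z] to the other side gives a vanishing sum with component -z in degree [i], where [c] is
   zero. *)
pose d j := c j - (if j == i then z else 0).
have sub := grading_submod gradL.
have gd j : (0 < j)%N -> g j (d j).
  move=> j_gt0; rewrite /d addrC -scaleN1r.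
  apply: (submodZD (sub _ j_gt0)) (gc _ j_gt0).
  by case: eqP => [-> //|_]; exact: submod0 (sub _ j_gt0).
have: \sum_(1 <= j < maxn N i.+1) d j = 0.
  rewrite sumrB -(@sum_nat_extend c N) ?leq_maxl // => [|j Hj]; last first.
    by apply: c0; rewrite Hj orbT.
  rewrite -zE -(@sum_nat_extend _ i.+1) ?leq_maxr // => [|j Hj]; last first.
    by rewrite gtn_eqF.
  rewrite big_nat_recr //= eqxx big_nat_cond big1 ?add0r ?subrr // => j.
  by rewrite andbT => /andP[_ ltji]; rewrite (ltn_eqF ltji).
move=> /(grading_direct gradL gd)/(_ i); rewrite /d eqxx c0 ?lt_in // sub0r.
by rewrite i_gt0 leq_max ltnSn orbT => /(_ isT)/eqP; rewrite oppr_eq0 => /eqP.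
Qed.

Lemma lie_power_tail n : (lie_power n.+1 `<=` grading_tail n.+1)%classic.
Proof.
elim: n => [|n IHn] z.
  move=> _.
  have [N [c [gc ->]]] := grading_sum gradL z.
  rewrite big_nat_cond; apply: (submod_sum (grading_tail_submod _)) => i.
  rewrite andbT => /andP[i_gt0 _].
  exact: grading_tail_homog (gc _ i_gt0).
rewrite [lie_power _]/(lie_prod (lie_power n.+1) setT).
move=> [m [c [v [vP ->]]]]; apply: (submod_sum (grading_tail_submod _)) => l _.
apply: (submodZ (grading_tail_submod _)).
have [a /IHn[N [d [gd d0 ->]]] [b _ <-]] := vP l.
have [M [f [gf ->]]] := grading_sum gradL b.
rewrite -[lie _ (\sum_(_ <= _ < _) _)]/(lier _ _) raddf_sum big_nat_cond.
apply: (submod_sum (grading_tail_submod _)) => i.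
rewrite andbT => /andP[i_gt0 _] /=; rewrite /lier raddf_sum big_nat_cond.
apply: (submod_sum (grading_tail_submod _)) => j; rewrite andbT => /andP[j_gt0 _] /=.
have [lt_in|le_ni] := ltnP i n.+1.
  by rewrite d0 ?lt_in // lie0l; exact: submod0 (grading_tail_submod _).
apply: (@grading_tail_homog _ (i + j)%N); [lia | lia |].
exact (grading_lie gradL i_gt0 j_gt0 (gd _ i_gt0) (gf _ j_gt0)).
Qed.

End Grading.

Lemma metabelian_quot (F : fieldType) (L : lieAlgType F) (I : lie_ideal L)
    (a b c d : L) : metabelian (lie_quot I) -> ideal_set I (lie (lie a b) (lie c d)).
Proof.
pose pi z : lie_quot I := \pi_(lie_quot I)%qT z.
have piE u v : lie (pi u) (pi v) = pi (lie u v) by exact: pi_lie.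
move=> metab.
have : (lie_prod (lie_prod setT setT) (lie_prod setT setT))%classic
         (pi (lie (lie a b) (lie c d))).
  rewrite -!piE; apply: sub_lin_span.
  have prod u v : lie_prod setT setT (lie (pi u) (pi v)).
    by apply: sub_lin_span; exists (pi u) => //; exists (pi v).
  by exists (lie (pi a) (pi b)) => //; exists (lie (pi c) (pi d)).
rewrite metab => /= H.
have /lie_quotP :
    (\pi_(lie_quot I) (lie (lie a b) (lie c d)) = \pi_(lie_quot I) 0%R)%qT.
  by rewrite pi_lie_quot0; exact: H.
by rewrite subr0 => /set_mem.
Qed.

(** * Products of chain elements *)

Section MetabelianChain.
Local Open Scope ring_scope.
Variables (F : fieldType) (L : lieAlgType F) (x y : L) (h : nat).
Local Notation ad n z := (iter n (lier x) z).
Local Notation e n := (ad n y).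
Local Notation w := (lie (e h) y).
Hypothesis ey0 : forall n, (0 < n < h)%N -> lie (e n) y = 0.

(** In the expansion of [e_i, [y x^j]] the term of index t contains [e_(i+t) y], which vanishes when
    i+t < h; only t = j remains. *)
Lemma lie_chain0 i j : (0 < i <= h)%N -> (i + j = h)%N ->
  lie (e i) (e j) = (-1) ^+ j *: w.
Proof.
move=> /andP[i_gt0 le_ih] ijh; rewrite lie_iter_lier big_ord_recr /= big1.
  by rewrite add0r binn mulr1 subnn /= -iterD addnC ijh.
move=> [t /= lt_tj] _; rewrite -iterD ey0 ?iter_lier0 ?scaler0 //; lia.
Qed.

(** The surviving terms have i+t = h or h+1, that is t = j-s or j-s+1: [ey0] kills the earlier ones,
    the last hypothesis the later ones. *)
Lemma lie_chain s i j : (0 < i <= h)%N -> (0 < s)%N -> (i + j = h + s)%N ->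
  (forall n, (h.+1 < n <= h + s)%N -> lie (e n) y = 0) ->
  lie (e i) (e j) = (-1) ^+ (j - s) *:
    ('C(j, s)%:R *: ad s w - 'C(j, s.-1)%:R *: ad s.-1 (lie (e h.+1) y)).
Proof.
move=> /andP[i_gt0 le_ih] s_gt0 ijh ey0'; rewrite lie_iter_lier.
set f := fun t : nat => ((-1) ^+ t * 'C(j, t)%:R) *:
  ad (j - t)%N (lie (ad t (e i)) y).
rewrite -(big_mkord xpredT f) (@big_cat_nat _ _ _ (j - s)) //=; last lia.
rewrite big_nat_cond big1 ?add0r => [|t /andP[/andP[_ ltt] _]]; last first.
  by rewrite /f -iterD ey0 ?iter_lier0 ?scaler0 //; lia.
have [lt1 lt2] : (j - s < j.+1 /\ (j - s).+1 < j.+1)%N by lia.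
rewrite (big_ltn lt1) (big_ltn lt2).
rewrite [X in _ + (_ + X)]big_nat_cond [X in _ + (_ + X)]big1 => [|t]; last first.
  move=> /andP[/andP[gtt ltt] _].
  by rewrite /f -iterD ey0' ?iter_lier0 ?scaler0 //; lia.
rewrite /f -!iterD addr0 subKn; last lia.
have -> : (j - (j - s).+1 = s.-1)%N by lia.
have -> : (j - s + i = h)%N by lia.
have -> : ((j - s).+1 + i = h.+1)%N by lia.
have -> : 'C(j, j - s) = 'C(j, s) by apply: bin_sub; lia.
have -> : 'C(j, (j - s).+1) = 'C(j, s.-1).
  by rewrite -bin_sub; [congr 'C(_, _); lia | lia].
by rewrite exprS -!scalerA scaleN1r -scalerN -scalerDr.
Qed.

End MetabelianChain.

(** * Two-dimensional subspaces *)

Section TwoDimensional.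
Local Open Scope ring_scope.
Variables (F : fieldType) (L : lieAlgType F).

Lemma has_dim2P (A : set L) : has_dim A 2 <->
  exists b0 b1, (forall a b : F, a *: b0 + b *: b1 = 0 -> a = 0 /\ b = 0) /\
    A = [set z | exists a b : F, z = a *: b0 + b *: b1]%classic.
Proof.
split=> [[b [freeb ->]]|[b0 [b1 [freeb ->]]]].
  exists (b ord0), (b (lift ord0 ord0)); split=> [a1 a2 ab0|].
    pose c (i : 'I_2) := if i == ord0 then a1 else a2.
    have /freeb c0 : \sum_i c i *: b i = 0 by rewrite big_ord_recl big_ord1.
    by split; [exact: (c0 ord0) | exact: (c0 (lift ord0 ord0))].
  apply/seteqP; split=> z /=; last first.
    move=> [a1 [a2 ->]]; exists (fun i : 'I_2 => if i == ord0 then a1 else a2).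
    by rewrite big_ord_recl big_ord1.
  move=> [c ->]; exists (c ord0), (c (lift ord0 ord0)).
  by rewrite big_ord_recl big_ord1.
exists (fun i : 'I_2 => if i == ord0 then b0 else b1); split=> [c|].
  rewrite big_ord_recl big_ord1 /= => /freeb[c0 c1] i.
  case: i => [[|[|//]] lti]; [rewrite -[RHS]c0 | rewrite -[RHS]c1].
    by congr c; apply/val_inj.
  by congr c; apply/val_inj.
apply/seteqP; split=> z /=.
  move=> [a1 [a2 ->]]; exists (fun i : 'I_2 => if i == ord0 then a1 else a2).
  by rewrite big_ord_recl big_ord1.
by move=> [c ->]; exists (c ord0), (c (lift ord0 ord0)); rewrite big_ord_recl big_ord1.
Qed.

Lemma has_dim2_not_line (A : set L) v :
  has_dim A 2 -> ~ (forall z, A z -> exists a : F, z = a *: v).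
Proof.
move=> /has_dim2P[b0 [b1 [freeb AE]]] Av.
have [a0 b0E] : exists a, b0 = a *: v.
  by apply: Av; rewrite AE; exists 1, 0; rewrite scale1r scale0r addr0.
have [a1 b1E] : exists a, b1 = a *: v.
  by apply: Av; rewrite AE; exists 0, 1; rewrite scale1r scale0r add0r.
(* For b0 = a0 v and b1 = a1 v the combination a1 b0 - a0 b1 is zero. *)
have [a10 _] : a1 = 0 /\ - a0 = 0.
  by apply: freeb; rewrite b0E b1E !scalerA mulNr mulrC scaleNr subrr.
have [_ /eqP] : 0 = 0 :> F /\ 1 = 0 :> F; last by rewrite oner_eq0.
by apply: freeb; rewrite b1E a10 !scale0r scaler0 addr0.
Qed.

End TwoDimensional.

(** * The covering property and the choice of a basis of L_1 *)

Section ThinAlgebra.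
Local Open Scope ring_scope.
Variables (F : fieldType) (L : lieAlgType F) (g : nat -> set L).
Hypothesis thinL : thin g.

Lemma thin_submod i : (0 < i)%N -> submod_closed [in g i].
Proof. exact: grading_submod (thin_grading thinL) i. Qed.

Lemma thin_lie1 i z t : (0 < i)%N -> g i z -> g 1%N t -> g i.+1 (lie z t).
Proof.
by move=> i_gt0 gz gt; rewrite -addn1; exact: (grading_lie (thin_grading thinL)).
Qed.

Section Basis.
Variables x y : L.
Hypothesis g1P : forall z, g 1%N z -> exists a b : F, z = a *: x + b *: y.

Lemma thin_cover i z u : (0 < i)%N -> g i z -> z <> 0 -> g i.+1 u ->
  exists a b : F, u = a *: lie z x + b *: lie z y.
Proof.
move=> i_gt0 gz z0; rewrite -(thin_covering thinL i_gt0 gz z0) => -[t gt <-].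
by have [a [b ->]] := g1P gt; exists a, b; rewrite lieDr !lieZr.
Qed.

Lemma thin_coverE i z : (0 < i)%N -> g i z -> z <> 0 -> g 1%N x -> g 1%N y ->
  g i.+1 = [set u | exists a b : F, u = a *: lie z x + b *: lie z y]%classic.
Proof.
move=> i_gt0 gz z0 gx gy; apply/seteqP; split=> u /=.
  exact: thin_cover i_gt0 gz z0.
move=> [a [b ->]]; have sub := @thin_submod i.+1 isT.
apply: (submodZD sub); first exact: thin_lie1.
by apply: (submodZ sub); exact: thin_lie1.
Qed.

(** Covering leaves only multiples of [z x] in the next component, and no component is zero. *)
Lemma thin_line i z : (0 < i)%N -> g i z -> z <> 0 -> lie z y = 0 ->
  lie z x <> 0 /\ forall u, g i.+1 u -> exists a : F, u = a *: lie z x.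
Proof.
move=> i_gt0 gz z0 zy0.
have line u : g i.+1 u -> exists a : F, u = a *: lie z x.
  move=> /(thin_cover i_gt0 gz z0)[a [b ->]].
  by exists a; rewrite zy0 scaler0 addr0.
split=> // zx0; apply: (@thin_neq0 _ _ _ thinL i.+1) => //.
apply/seteqP; split=> u /=; first by move=> /line[a ->]; rewrite zx0 scaler0.
by move=> ->; exact: submod0 (@thin_submod i.+1 isT).
Qed.

End Basis.

Lemma thin_dependent x y i z :
  g 1%N x -> g 1%N y ->
  (forall z, g 1%N z -> exists a b : F, z = a *: x + b *: y) ->
  (0 < i)%N -> g i z -> z <> 0 -> ~ has_dim (g i.+1) 2 ->
  exists a b : F, (a != 0) || (b != 0) /\ lie z (a *: x + b *: y) = 0.
Proof.
move=> gx gy g1P i_gt0 gz z0 ndim; apply: contrapT => nex; apply: ndim.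
apply/has_dim2P; exists (lie z x), (lie z y); split; last first.
  exact: (thin_coverE g1P).
move=> a b ab0; apply: contrapT => nab; apply: nex; exists a, b.
split; last by rewrite lieDr !lieZr.
rewrite -negb_and; apply/negP => /andP[/eqP a0 /eqP b0].
by apply: nab; rewrite a0 b0.
Qed.

Lemma thin_basis : ~ has_dim (g 3) 2 ->
  exists x y, [/\ g 1%N x, g 1%N y, y <> 0, lie (lie y x) y = 0 &
    forall z, g 1%N z -> exists a b : F, z = a *: x + b *: y].
Proof.
have /has_dim2P[b0 [b1 [freeb g1E]]] := thin_dim1 thinL.
have g1P z : g 1%N z -> exists a b : F, z = a *: b0 + b *: b1 by rewrite g1E.
have gb0 : g 1%N b0.
  by rewrite g1E; exists 1, 0; rewrite scale1r scale0r addr0.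
have gb1 : g 1%N b1.
  by rewrite g1E; exists 0, 1; rewrite scale1r scale0r add0r.
have b00 : b0 <> 0.
  move=> b00; have [/eqP] : 1 = 0 :> F /\ 0 = 0 :> F; last by rewrite oner_eq0.
  by apply: freeb; rewrite b00 scaler0 scale0r addr0.
have g1P' z : g 1%N z -> exists a b : F, z = a *: b1 + b *: b0.
  by move=> /g1P[a [b ->]]; exists b, a; rewrite addrC.
have [b01 _] := thin_line g1P' (ltn0Sn 0) gb0 b00 (liexx _).
move=> /(thin_dependent gb0 gb1 g1P (ltn0Sn 1) (thin_lie1 (ltn0Sn 0) gb0 gb1) b01).
move=> [a [b [ab0 zy0]]]; set y := a *: b0 + b *: b1 in zy0.
have gy : g 1%N y by rewrite g1E; exists a, b.
have y0 : y <> 0 by move=> /freeb[a0 b0']; move: ab0; rewrite a0 b0' eqxx.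
(* Complete [y] to a basis by [b1] if a is nonzero, and by [b0] otherwise; then [y x] is a multiple
   of [b0 b1], which [y] centralizes. *)
have [a0|a0] := eqVneq a 0; last first.
  exists b1, y; split=> //.
    by rewrite {1}/y lieDl !lieZl liexx scaler0 addr0 lieZl zy0 scaler0.
  move=> z /g1P[c [d ->]]; exists (d - c / a * b), (c / a).
  rewrite /y scalerDr !scalerA divfK // [RHS]addrCA; congr (_ + _).
  by rewrite -scalerDl subrK.
have b0' : b != 0 by move: ab0; rewrite a0 eqxx.
exists b0, y; split=> //.
  rewrite {1}/y lieDl !lieZl liexx scaler0 add0r lieZl (lieC b1) lieNl zy0.
  by rewrite oppr0 scaler0.
move=> z /g1P[c [d ->]]; exists c, (d / b).
by rewrite /y a0 scale0r add0r scalerA divfK.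
Qed.

End ThinAlgebra.

(** Meant for positive [s]: at s = 0 the truncated predecessor would add a spurious -m. *)
Definition chain_coef (F : fieldType) (m s j : nat) : F :=
  ('C(j, s)%:R - m%:R * 'C(j, s.-1)%:R)%R.

(** * The second diamond and the component after it *)

Section SecondDiamond.
Local Open Scope ring_scope.
Variables (F : fieldType) (L : lieAlgType F) (g : nat -> set L).
Variables (x y : L) (h : nat).
Local Notation ad n z := (iter n (lier x) z).
Local Notation e n := (ad n y).
Local Notation w := (lie (e h) y).
Local Notation c := (chain_coef F h.+1./2).
Hypotheses (thinL : thin g) (h_gt1 : (1 < h)%N) (dimk : has_dim (g h.+2) 2).
Hypotheses (gx : g 1 x) (gy : g 1 y) (y_neq0 : y <> 0).
Hypothesis g1P : forall z, g 1%N z -> exists a b : F, z = a *: x + b *: y.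
Hypothesis ey0 : forall n, (0 < n < h)%N -> lie (e n) y = 0.

Lemma ad_grading n i z : (0 < i)%N -> g i z -> g (i + n)%N (ad n z).
Proof.
move=> i_gt0 gz; elim: n => [|n IHn]; first by rewrite addn0.
by rewrite addnS; apply: thin_lie1 => //; rewrite addn_gt0 i_gt0.
Qed.

Lemma chain_grading n : g n.+1 (e n).
Proof. exact: (@ad_grading n 1). Qed.

(** As [y] kills e_n for n < h, covering forces [e_n x] to be nonzero. *)
Lemma chain_neq0 n : (n <= h)%N -> e n <> 0.
Proof.
elim: n => [|n IHn] // ltnh.
have [|//] := thin_line thinL g1P (ltn0Sn n) (chain_grading n) (IHn (ltnW ltnh)).
by case: n ltnh {IHn} => [|n] ltnh; [rewrite /= liexx | exact: ey0].
Qed.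

Let gw : g h.+2 w := thin_lie1 thinL (ltn0Sn h) (chain_grading h) gy.

Lemma diamondP u : g h.+2 u -> exists a b : F, u = a *: e h.+1 + b *: w.
Proof.
exact: (thin_cover thinL g1P (ltn0Sn h) (chain_grading h) (chain_neq0 (leqnn h))).
Qed.

Lemma diamond_w_neq0 : w <> 0.
Proof.
move=> w0; apply: (has_dim2_not_line (v := e h.+1) dimk) => u /diamondP[a [b ->]].
by exists a; rewrite w0 scaler0 addr0.
Qed.

Lemma diamond_neq0 a : e h.+1 - a *: w <> 0.
Proof.
move=> /eqP; rewrite subr_eq0 => /eqP eE.
apply: (has_dim2_not_line (v := w) dimk) => u /diamondP[b [d ->]].
by exists (b * a + d); rewrite eE scalerA -scalerDl.
Qed.

(** For even h, the zero product of e_(h/2) with itself would equal w up to sign. *)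
Lemma odd_chain : odd h.
Proof.
apply/negPn/negP => hE.
have hh : (h./2 + h./2 = h)%N by lia.
have := lie_chain0 ey0 (i := h./2) (j := h./2) _ hh.
rewrite liexx => /(_ _)/esym/eqP; rewrite scaler_eq0 signr_eq0 /=.
by move=> H; apply: diamond_w_neq0; apply/eqP/H; lia.
Qed.

(** Expand [e_(h-1), [e_1 y]]: [y] kills both e_1 and e_(h-1), and [e_(h-1), e_1] = -w. *)
Lemma diamond_wy : lie w y = 0.
Proof.
have := lie_liel (e h.-1) (e 1) y.
rewrite ey0 // raddf0 (@ey0 h.-1) ?lie0l ?subr0; last lia.
rewrite (@lie_chain0 _ _ _ _ _ ey0) ?expr1 ?scaleN1r ?lieNl; [|lia..].
by move/esym/eqP; rewrite oppr_eq0 => /eqP.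
Qed.

Lemma diamond_next : lie w x <> 0 /\
  forall u, g h.+3 u -> exists a : F, u = a *: lie w x.
Proof. exact (thin_line thinL g1P (ltn0Sn _) gw diamond_w_neq0 diamond_wy). Qed.

(** Expand [e_m, e_m] = 0 in degree 2m+2 = k+1. *)
Lemma diamond_vxy : lie (e h.+1) y = h.+1./2%:R *: lie w x.
Proof.
have hodd := odd_chain.
have := @lie_chain _ _ _ _ _ ey0 1 (h.+1./2) (h.+1./2).
rewrite liexx bin1 bin0 scale1r => /(_ _ _ _ _)/esym/eqP.
rewrite scaler_eq0 signr_eq0 subr_eq0 => H.
by apply/esym/eqP/H => //; [lia | lia | move=> n; lia].
Qed.

(** If m = 0 in F, then [y] kills L_k. Writing e_(h+2) = a [w x], the nonzero element e_(h+1) - a w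
    is killed by [x] too, against covering. *)
Lemma chain_half_neq0 : h.+1./2%:R != 0 :> F.
Proof.
have [_ /(_ (e h.+2) (chain_grading _))[a ea]] := diamond_next.
apply/eqP => m0; have gz : g h.+2 (e h.+1 - a *: w).
  rewrite addrC -scaleNr; apply: (submodZD (thin_submod thinL _)) => //.
  exact: chain_grading.
have [|+ _] := thin_line thinL g1P (ltn0Sn _) gz (@diamond_neq0 a).
  by rewrite lieBl lieZl diamond_wy diamond_vxy m0 scale0r scaler0 subr0.
by apply; rewrite lieBl lieZl -ea subrr.
Qed.

(** * Products in degree k+s *)

Section Stage.
Variable s : nat.
Hypotheses (s_gt0 : (0 < s)%N).
Hypothesis wy0 : forall t, (0 < t < s)%N -> lie (ad t w) y = 0.

Lemma tail_neq0 : ad s w <> 0.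
Proof.
have H t : (t <= s)%N -> ad t w <> 0.
  elim: t => [_|t IHt ltts]; first exact: diamond_w_neq0.
  have gt := @ad_grading t h.+2 w isT gw.
  have [|//] := thin_line thinL g1P (ltn0Sn (h.+1 + t)) gt (IHt (ltnW ltts)).
  by case: t ltts {IHt gt} => [|t] ltts; [exact: diamond_wy | exact: wy0].
exact: H.
Qed.

Lemma lie_chain_tail i j : (0 < i <= h)%N -> (i + j = h + s)%N ->
  lie (e i) (e j) = ((-1) ^+ (j - s) * c s j) *: ad s w.
Proof.
move=> ih ijh; rewrite (@lie_chain _ _ _ _ _ ey0 s) // => [|n /andP[lthn lens]].
  rewrite diamond_vxy iter_lierZ -[lie w x]/(ad 1 w) -iterD addn1 prednK //.
  by rewrite !scalerA -scalerBl scalerA [_ * h.+1./2%:R]mulrC.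
(* As e_(h+2) = a [w x], each e_n with h+1 < n <= h+s is a multiple of [w x^(n-h-1)], which [y]
   kills by [wy0]. *)
have [_ /(_ (e h.+2) (chain_grading _))[a ea]] := diamond_next.
have -> : (n = n - h.+2 + h.+2)%N by lia.
rewrite iterD ea iter_lierZ lieZl -[lie w x]/(ad 1 w) -iterD wy0 ?scaler0 //; lia.
Qed.

(** For i = h+s-j both i and j lie strictly between s and h, so [y] kills e_i and e_j, hence
    [e_i, e_j], which is c_s(j) [w x^s] up to sign. *)
Lemma tail_centralized j : (s < j < h)%N -> c s j != 0 -> lie (ad s w) y = 0.
Proof.
move=> /andP[ltsj ltjh] c0; have := lie_liel (e (h + s - j)) (e j) y.
rewrite (@ey0 j) ?(@ey0 (h + s - j)); [|lia..].
rewrite raddf0 lie0l subr0 lie_chain_tail; [|lia..].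
rewrite lieZl => /esym/eqP; rewrite scaler_eq0 mulf_eq0 signr_eq0 (negPf c0) /=.
by move/eqP.
Qed.

Lemma tail_skew i j : (0 < i <= h)%N -> (0 < j <= h)%N -> (i + j = h + s)%N ->
  (-1) ^+ (j - s) * c s j + (-1) ^+ (i - s) * c s i = 0.
Proof.
move=> ih jh ijh; apply/eqP; have := lieC (e i) (e j).
rewrite !lie_chain_tail //; last by rewrite addnC.
move=> /eqP; rewrite -subr_eq0 opprK -scalerDl scaler_eq0.
by case/orP => // /eqP; have := tail_neq0.
Qed.

(** Using [e_i, e_i] = 0 instead of skew-symmetry avoids a factor 2. *)
Lemma tail_diag i : (0 < i <= h)%N -> (i + i = h + s)%N -> c s i = 0.
Proof.
move=> ih iih; have := liexx (e i); rewrite lie_chain_tail // => /eqP.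
rewrite scaler_eq0 mulf_eq0 signr_eq0 /=.
by case/orP => /eqP //; have := tail_neq0.
Qed.

End Stage.

(** Strong induction on t replaces the Lie-theoretic hypothesis [wy0] by an arithmetic one. *)
Lemma tail_centralized_lt s :
  (forall t, (0 < t < s)%N -> exists2 j, (t < j < h)%N & c t j != 0) ->
  forall t, (0 < t < s)%N -> lie (ad t w) y = 0.
Proof.
move=> H t; elim/ltn_ind: t => t IHt ts; have [j tj c0] := H t ts.
apply: (tail_centralized _ _ tj c0) => [|r rt]; first lia.
by apply: IHt; lia.
Qed.

End SecondDiamond.

(** * Vanishing products from the metabelian quotient *)

Section Metabelian.
Local Open Scope ring_scope.
Variables (F : fieldType) (L : lieAlgType F) (g : nat -> set L).

(** By covering, homogeneous elements of degree above 1 are single brackets, so [a b] lies in L^k;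
    its degree being below k, it is zero. *)
Lemma thin_metabelian_eq0 k i j a b : thin g ->
  metabelian (lie_quot (lie_power_ideal L k)) -> (1 < i)%N -> (1 < j)%N ->
  (i + j < k)%N -> g i a -> g j b -> lie a b = 0.
Proof.
move=> thinL metab i_gt1 j_gt1 ltk ga gb.
have prod l z : (1 < l)%N -> g l z -> exists u v, z = lie u v.
  case: l => [|[|l]] // _ gz.
  have [t [gt t0]] : exists t, g l.+1 t /\ t <> 0.
    apply: contrapT => H; apply: (@thin_neq0 _ _ _ thinL l.+1) => //.
    apply/seteqP; split=> t /=.
      by move=> gt; apply: contrapT => t0; apply: H; exists t.
    by move=> ->; exact: submod0 (thin_submod thinL _).
  move: gz; rewrite -(thin_covering thinL _ gt t0) // => -[v _ <-].
  by exists t, v.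
have [u [v aE]] := prod _ _ i_gt1 ga; have [u' [v' bE]] := prod _ _ j_gt1 gb.
have : lie_power k (lie a b) by rewrite aE bE; exact: metabelian_quot metab.
case: k ltk {metab} => // k ltk /(lie_power_tail (thin_grading thinL)).
apply: (@grading_tail_eq0 _ _ _ (thin_grading thinL) k.+1 (i + j)%N); first lia.
by apply: (grading_lie (thin_grading thinL)) => //; lia.
Qed.

End Metabelian.

(** * Arithmetic of the coefficients c_s(j) *)

Section ChainCoefficients.
Local Open Scope ring_scope.
Variables (F : fieldType) (h : nat).
Hypothesis h_odd : odd h.
Local Notation m := (h.+1./2).
Local Notation c := (chain_coef F m).
(** Under this condition [y] kills [w x^t] for 0 < t < s. The Lie algebra enters this section only
    through the hypotheses stated here. *)
Local Notation nonvanishing s :=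
  (forall t, (0 < t < s)%N -> exists2 j, (t < j < h)%N & c t j != 0).
Hypothesis m_neq0 : m%:R != 0 :> F.
Hypothesis skew : forall s, (0 < s <= h)%N -> nonvanishing s ->
  (-1) ^+ (h - s) * c s h + c s s = 0.
Hypothesis diag : forall s, (0 < s)%N -> nonvanishing s ->
  forall i, (0 < i <= h)%N -> (i + i = h + s)%N -> c s i = 0.

Lemma chain_coefN1 s j : m%:R = -1 :> F -> (0 < s)%N -> c s j = 'C(j.+1, s)%:R.
Proof.
by case: s => // s mN1 _; rewrite /chain_coef mN1 mulN1r opprK binS natrD.
Qed.

(** The case k = 2m+1 = 0 in F; doubling avoids division by 2. *)
Lemma chain_coef_half s j : m%:R *+ 2 = -1 :> F -> (0 < s)%N ->
  c s j *+ 2 = 'C(j.+1, s)%:R + 'C(j, s)%:R.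
Proof.
case: s => // s m2 _; rewrite /chain_coef mulrnBl -mulrnAl m2 /= binS natrD.
by ring.
Qed.

Lemma chain_length_generic : (3 < h)%N -> m.+1%:R != 0 :> F ->
  h.+2%:R != 0 :> F -> False.
Proof.
move=> h_gt3 m1_neq0 h2_neq0.
have bin2m : m.+1%:R * m%:R = 2 * 'C(m.+1, 2)%:R :> F.
  by rewrite -!natrM -mul_bin_diag bin1.
have two_neq0 : 2 != 0 :> F.
  apply/eqP => two0; move/eqP: bin2m; rewrite two0 mul0r mulf_eq0.
  by rewrite (negPf m_neq0) (negPf m1_neq0).
(* Here c_1(3) - c_1(2) = 1 and c_2(4) - 2 c_2(3) = 2m, so each pair has a nonzero member; h odd and
   above 3 gives 4 < h. *)
have nv : nonvanishing 3.
  move=> [|[|[|//]]] // _.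
    have [c12|] := eqVneq (c 1 2) 0; last by exists 2; [lia|].
    exists 3; first lia; move: c12; rewrite /chain_coef !bin1 !bin0 => c12.
    apply/eqP => c13; have /eqP[] := oner_neq0 F.
    by rewrite -[RHS](subrr 0) -{1}c13 -c12; ring.
  have [c23|] := eqVneq (c 2 3) 0; last by exists 3; [lia|].
  exists 4; first lia; move: c23.
  rewrite /chain_coef /= (_ : 'C(3, 2) = 3) // (_ : 'C(4, 2) = 6) // !bin1 => c23.
  apply/eqP => c24; have /eqP[] := mulf_neq0 two_neq0 m_neq0.
  by rewrite -[RHS](subrr 0) -{1}c24 -(mulr0 2) -c23; ring.
have bin3m : 3 * 'C(m.+1, 3)%:R = (m%:R - 1) * 'C(m.+1, 2)%:R :> F.
  by rewrite -natrM mul_bin_left natrM subSS natrB //; lia.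
have : c 3 m.+1 = 0 by apply: diag => //; lia.
rewrite /chain_coef /= => c3.
have h2E : h.+2%:R = 2 * m%:R + 1 :> F by rewrite -natrM natr1; congr _%:R; lia.
have /eqP[] := mulf_neq0 (mulf_neq0 m1_neq0 m_neq0) h2_neq0.
rewrite h2E -[RHS](mul0r (- 6)) -c3.
transitivity (6 * (m%:R * 'C(m.+1, 2)%:R) - 2 * (3 * 'C(m.+1, 3)%:R) :> F).
  by rewrite bin3m bin2m; ring.
by ring.
Qed.

Section Characteristic.
Variables (p e N : nat).
Hypotheses (charFp : p \in [pchar F]) (e_gt0 : (0 < e)%N).
Local Notation Q := (p ^ e)%N.
Hypotheses (N_gt2 : (2 < N)%N).

Let Q_gt1 : (1 < Q)%N.
Proof. by rewrite -(exp1n e) ltn_exp2r // prime_gt1 ?(pcharf_prime charFp). Qed.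

(** Here c_s(j) = C(j+1,s). At s = Q, c_Q(h) = C((N-1)Q + Q-2, Q) = N-1 and c_Q(Q) = C(Q+1,Q) = 1;
    by parity [skew] adds them. *)
Lemma chain_length_even : (h.+3 = N * Q)%N -> m%:R = -1 :> F ->
  (p == 2) || ~~ odd (h - Q) -> N%:R = 0 :> F.
Proof.
move=> hE mN1 par.
have Q3 : (3 * Q <= N * Q)%N by rewrite leq_mul2r N_gt2 orbT.
have nv : nonvanishing Q.
  (* This j gives c_t(j) = C(Q+t,t) = C(t,t) = 1, and j < h since N > 2. *)
  move=> t /andP[t_gt0 ltt]; exists (Q + t).-1; first lia.
  rewrite chain_coefN1 // prednK; last lia.
  by rewrite (bin_pchar_addl charFp) 1?ltnW // (ltn_eqF ltt) binn addr0 oner_eq0.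
have /andP[Q_gt0 le_Qh] : (0 < Q <= h)%N by lia.
have := skew _ nv; rewrite Q_gt0 le_Qh => /(_ isT).
rewrite !chain_coefN1 // -[Q.+1]addn1.
rewrite (bin_pchar_addl charFp) // (bin_small Q_gt1) eqxx add0r.
have -> : (h.+1 = N.-1 * Q + (Q - 2))%N by rewrite -subn1 mulnBl mul1n; lia.
rewrite (bin_pchar_eq charFp); last lia.
have -> : (-1) ^+ (h - Q) = 1 :> F.
  case/orP: par => [/eqP p2|hQ]; last by rewrite -signr_odd (negPf hQ).
  have char2 : 2 \in [pchar F] by rewrite -p2.
  by rewrite (oppr_pchar2 char2) expr1n.
by rewrite mul1r natr1 prednK //; lia.
Qed.

(** The same comparison at s = Q, doubled: 2 c_Q(h) = 2(N-1) and 2 c_Q(Q) = 2. *)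
Lemma chain_length_odd : (h.+2 = N * Q)%N -> m%:R *+ 2 = -1 :> F ->
  ~~ odd (h - Q) -> (N%:R *+ 2) = 0 :> F.
Proof.
move=> hE m2 par.
have Q3 : (3 * Q <= N * Q)%N by rewrite leq_mul2r N_gt2 orbT.
have nv : nonvanishing Q.
  (* Now 2 c_t(j) = C(Q+t,t) + C(Q+t-1,t) = 1 + 0. *)
  move=> t /andP[t_gt0 ltt]; exists (Q + t).-1; first lia.
  apply/eqP => c0; have := @chain_coef_half t (Q + t).-1 m2 t_gt0.
  rewrite c0 mul0rn prednK; last lia.
  have -> : (Q + t).-1 = (Q + t.-1)%N by lia.
  rewrite !(bin_pchar_addl charFp) 1?ltnW // (ltn_eqF ltt) binn !addr0.
  by rewrite bin_small ?prednK // addr0 => /esym/eqP; rewrite oner_eq0.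
have /andP[Q_gt0 le_Qh] : (0 < Q <= h)%N by lia.
have := skew _ nv; rewrite Q_gt0 le_Qh => /(_ isT)/(congr1 (fun z => z *+ 2)).
rewrite -signr_odd (negPf par) mul1r mulrnDl !chain_coef_half // mul0rn.
rewrite -[Q.+1]addn1 (bin_pchar_addl charFp) // (bin_small Q_gt1) eqxx binn add0r.
have -> : (h.+1 = N.-1 * Q + (Q - 1))%N by rewrite -subn1 mulnBl mul1n; lia.
have -> : (h = N.-1 * Q + (Q - 2))%N by rewrite -subn1 mulnBl mul1n; lia.
rewrite !(bin_pchar_eq charFp); [|lia..].
rewrite -!mulr2n -mulrnDl natr1 prednK //; lia.
Qed.

End Characteristic.

Lemma chain_length (p : nat) : has_char F p -> (1 < h)%N ->
  (h.+2 = 5 \/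
     (0 < p /\ exists q, is_power p q /\ (h.+2 = q \/ h.+2 = 2 * q - 1)))%N
  /\ (p = 2 -> exists q, is_power 2 q /\ h.+2 = 2 * q - 1)%N.
Proof.
have h2m : (h.+3 = 2 * m.+1)%N by lia.
case: p => [|p'] charF h_gt1.
  have nat0 n : n.+1%:R != 0 :> F by rewrite ((pcharf0P F).1 charF).
  split=> //; left; have [h_gt3|] := ltnP 3 h; last lia.
  by case: (chain_length_generic h_gt3 (nat0 _) (nat0 _)).
set p := p'.+1 in charF *.
have p_pr : prime p := pcharf_prime charF.
have oddp : p = 2%N \/ odd p by case: (even_prime p_pr); [left | right].
have [p_h3|p_h3] := boolP (p %| h.+3)%N.
  have mN1 : m%:R = -1 :> F.
    apply/eqP; rewrite -addr_eq0 natr1 -(dvdn_pcharf charF).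
    (* For odd p, cancel 2 in k+1 = 2(m+1); for p = 2, m nonzero in F means m odd. *)
    case: oddp => [p2|oddp]; last first.
      by move: p_h3; rewrite h2m Gauss_dvdr // prime_coprime // dvdn_prime2 //; lia.
    move: m_neq0; rewrite -(dvdn_pcharf charF) p2; lia.
  have [N copN hE] := pfactor_coprime p_pr (ltn0Sn h.+2).
  set e := logn p h.+3 in hE.
  have e_gt0 : (0 < e)%N by rewrite logn_gt0 mem_primes p_pr.
  have N_gt0 : (0 < N)%N by case: N hE {copN}.
  have le_N2 : (N <= 2)%N.
    rewrite leqNgt; apply/negP => N_gt2.
    have /eqP : N%:R = 0 :> F.
      apply: (chain_length_even charF e_gt0 N_gt2 hE mN1).
      case: oddp => [->//|oddp]; apply/orP; right.
      have oQ : odd (p ^ e) by rewrite oddX oddp orbT.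
      have : (3 * p ^ e <= N * p ^ e)%N by rewrite leq_mul2r N_gt2 orbT.
      lia.
    by rewrite -(dvdn_pcharf charF); apply/negP; rewrite -prime_coprime.
  case: oddp => [p2|oddp].
    have N1 : (N = 1)%N.
      move: copN; rewrite p2 coprime2n; case: (N) N_gt0 le_N2 => [|[|[|]]] //.
    (* e = 1 would give k = 1; the exponent e-1 must be positive in [is_power]. *)
    have e_gt1 : (1 < e)%N.
      rewrite ltnNge; apply/negP => e_le1; have e1 : e = 1%N by lia.
      by move: hE; rewrite N1 e1 p2; lia.
    have pw : is_power 2 (2 ^ e.-1) by exists e.-1 => //; lia.
    have kE : (h.+2 = 2 * 2 ^ e.-1 - 1)%N.
      by rewrite -expnS prednK ?(ltnW e_gt1) // -p2; move: hE; rewrite N1; lia.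
    split; last by move=> _; exists (2 ^ e.-1)%N.
    by right; split => //; exists (2 ^ e.-1)%N; rewrite p2; split => //; right.
  have oQ : odd (p ^ e) by rewrite oddX oddp orbT.
  split; last by move=> p2; rewrite p2 in oddp.
  right; split => //; exists (p ^ e)%N; split; first by exists e.
  (* k+1 is even and Q odd, so N = 2. *)
  by right; case: (N) N_gt0 le_N2 hE => [|[|[|]]] // _ _; lia.
have {}oddp : odd p.
  by case: oddp => // p2; move: p_h3; rewrite p2 h2m dvdn_mulr.
split; last by move=> p2; rewrite p2 in oddp.
have [p_h2|p_h2] := boolP (p %| h.+2)%N; last first.
  left; have [h_gt3|] := ltnP 3 h; last lia.
  case: (chain_length_generic h_gt3); rewrite -(dvdn_pcharf charF) //.
  by apply: contra p_h3; rewrite h2m => /dvdn_mull ->.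
right; split => //.
have [N copN hE] := pfactor_coprime p_pr (ltn0Sn h.+1).
set e := logn p h.+2 in hE.
have e_gt0 : (0 < e)%N by rewrite logn_gt0 mem_primes p_pr.
have oQ : odd (p ^ e) by rewrite oddX oddp orbT.
exists (p ^ e)%N; split; first by exists e.
left; rewrite hE; suff -> : N = 1%N by rewrite mul1n.
(* k is odd, hence so is N, which leaves N = 1 once N > 2 is excluded. *)
have /andP[oN _] : odd N && odd (p ^ e) by rewrite -oddM -hE; lia.
have [N_gt2|] := ltnP 2 N; last by lia.
have m2 : m%:R *+ 2 = -1 :> F.
  apply/eqP; rewrite -addr_eq0 -mulrnA natr1 -(dvdn_pcharf charF).
  by have -> : ((m * 2).+1 = h.+2)%N by lia.
have /eqP : N%:R *+ 2 = 0 :> F.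
  apply: (chain_length_odd charF e_gt0 N_gt2 hE m2).
  have : (3 * p ^ e <= N * p ^ e)%N by rewrite leq_mul2r N_gt2 orbT.
  lia.
rewrite -mulrnA -(dvdn_pcharf charF) Euclid_dvdM // => /orP[pN|].
  by move: copN; rewrite prime_coprime // pN.
by rewrite dvdn_prime2 // => /eqP p2; rewrite p2 in oddp.
Qed.

End ChainCoefficients.

(** * Existence of the chain *)

Section ChainExistence.
Local Open Scope ring_scope.
Variables (F : fieldType) (L : lieAlgType F) (g : nat -> set L).
Hypothesis thinL : thin g.

Lemma thin_component2_not_dim2 : ~ has_dim (g 2) 2.
Proof.
have [b0 [b1 [freeb g1E]]] := (has_dim2P (g 1)).1 (thin_dim1 thinL).
have g1P z : g 1%N z -> exists a b : F, z = a *: b1 + b *: b0.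
  by rewrite g1E => -[a [b ->]]; exists b, a; rewrite addrC.
have gb0 : g 1%N b0.
  by rewrite g1E; exists 1, 0; rewrite scale1r scale0r addr0.
have b0_neq0 : b0 <> 0.
  move=> b00; have [/eqP] : 1 = 0 :> F /\ 0 = 0 :> F; last by rewrite oner_eq0.
  by apply: freeb; rewrite b00 scaler0 scale0r addr0.
have [_ line] := thin_line thinL g1P (ltn0Sn 0) gb0 b0_neq0 (liexx _).
by move=> dim2; exact: has_dim2_not_line dim2 line.
Qed.

(** Start from [y] killing [y x]. While n+3 < k, [e_n, [x y]] = 0 by the metabelian quotient, so
    [e_n y] = 0 implies [e_n x y] = 0. *)
Lemma thin_chain h : (1 < h)%N -> second_diamond g h.+2 ->
    metabelian (lie_quot (lie_power_ideal L h.+2)) ->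
  exists x y, [/\ g 1%N x, g 1%N y, y <> 0,
    forall z, g 1%N z -> exists a b : F, z = a *: x + b *: y &
    forall n, (0 < n < h)%N -> lie (iter n (lier x) y) y = 0].
Proof.
move=> h_gt1 [_ _ ndim] metab.
have [|x [y [gx gy y_neq0 yxy0 g1P]]] := thin_basis thinL.
  by apply: ndim; lia.
exists x, y; split=> // n /andP[]; elim: n => // -[_ _ _ //|n IHn] _ ltnh.
have [gn gyx] := (chain_grading thinL gx gy n.+1, thin_lie1 thinL (ltn0Sn 0) gx gy).
have := lie_liel (iter n.+1 (lier x) y) x y.
rewrite IHn // ?(ltnW ltnh) // lie0l subr0 => <-.
by apply: (thin_metabelian_eq0 thinL metab) gn gyx => //; lia.
Qed.

End ChainExistence.

Theorem theorem6 (F : fieldType) (p : nat) (L : lieAlgType F)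
    (g : nat -> set L) (k : nat)
    (charF : has_char F p)
    (thinL : thin g)
    (Lk : second_diamond g k)
    (metab : metabelian (lie_quot (lie_power_ideal L k))) :
  (k = 3 \/ k = 5 \/
     (0 < p /\ exists q, is_power p q /\ (k = q \/ k = 2 * q - 1)))
  /\ (p = 2 -> k = 3 \/ exists q, is_power 2 q /\ k = 2 * q - 1).
Proof.
case: k Lk metab => [|[|h]] Lk metab; try by case: Lk.
have dimk : has_dim (g h.+2) 2 by case: Lk.
(* k = 2 is impossible and k = 3 is allowed; from here on [h.+2] stands for k-2. *)
case: h => [|[|h]] in Lk metab dimk *;
  [by case: (thin_component2_not_dim2 thinL) | by split=> [|_]; left |].
have h_gt1 : 1 < h.+2 by [].
have [x [y [gx gy y_neq0 g1P ey0]]] := thin_chain thinL h_gt1 Lk metab.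
have h_odd := odd_chain thinL h_gt1 dimk gx gy y_neq0 g1P ey0.
have m_neq0 := chain_half_neq0 thinL h_gt1 dimk gx gy y_neq0 g1P ey0.
have [||kP kP2] := chain_length h_odd m_neq0 _ _ charF h_gt1.
- move=> s /andP[s_gt0 le_sh].
  move=> /(tail_centralized_lt thinL h_gt1 dimk gx gy y_neq0 g1P ey0) wy0.
  have := tail_skew thinL h_gt1 dimk gx gy y_neq0 g1P ey0 s_gt0 wy0
    (i := s) (j := h.+2).
  by rewrite subnn mul1r; apply; lia.
- move=> s s_gt0.
  move=> /(tail_centralized_lt thinL h_gt1 dimk gx gy y_neq0 g1P ey0) wy0.
  exact: (tail_diag thinL h_gt1 dimk gx gy y_neq0 g1P ey0 s_gt0 wy0).
by split=> [|/kP2]; right.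
Qed.
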